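(* Let $R$ be a left Zacharias domain, $\mathsf R$ a multivariate Ore extension of $R$ in which each $\alpha_i$ is an automorphism of $R$, and $F=\{g_1,\dots,g_u\}\subset\mathsf R^m\setminus\{0\}$ a finite set with $\mathbf M(g_i)=c_i\tau_i\mathbf e_{l_i}$. Let $\mathsf T$ be the set of all terms $\mathrm{lcm}(\tau_i:i\in H)\,\mathbf e_{l}$, where $H$ ranges over the nonempty subsets of $\{1,\dots,u\}$ on which $i\mapsto l_i$ is constant, with value $l$. For $\mathsf m=\delta\epsilon\in\mathsf T$ let $t_i(\mathsf m)=\delta/\tau_i$ and $v(\mathsf m)_i=\alpha_{t_i(\mathsf m)}(c_i)$ if $\mathbf T(g_i)\mid\mathsf m$, and $t_i(\mathsf m)=v(\mathsf m)_i=0$ otherwise; let $C(\mathsf m)\subset R^u$ be a finite generating set of the left $R$-module $\{(d_1,\dots,d_u)\in R^u:\sum_id_iv(\mathsf m)_i=0\}$ and $S(\mathsf m)=\{(d_1t_1(\mathsf m),\dots,d_ut_u(\mathsf m)):(d_i)\in C(\mathsf m)\}$; let $\mathcal S(F)=\bigcup_{\mathsf m\in\mathsf T}S(\mathsf m)$. Let $\mathcal S'(F)\subset\mathcal S(F)$ be any subset such that each $\sigma\in\mathcal S(F)\setminus\mathcal S'(F)$ can be written as a finite sum $\sigma=\sum_jd_j\omega_j\ast\sigma_j$ with $\sigma_j\in\mathcal S'(F)$, $d_j\in R$, $\omega_j\in\mathcal T$, and let $\mathcal R(F)=\{\sum_im_i\star g_i:(m_1,\dots,m_u)\in\mathcal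 S'(F)\}$. Then: (1) $\mathcal S'(F)$ is a left Gebauer–Möller set for $F$; (2) $F$ is a left Gröbner basis of the left module it generates if and only if each $h\in\mathcal R(F)$ has a left Gröbner representation in terms of $F$.
   Context: **Ore extensions.** $R$ is a (not necessarily commutative) domain with identity. A multivariate Ore extension $\mathsf R=R[Y_1;\alpha_1,\delta_1]\cdots[Y_n;\alpha_n,\delta_n]$ is an iterated Ore extension ($Y_i\star r=\alpha_i(r)Y_i+\delta_i(r)$, $\alpha_i$ an injective ring endomorphism mapping $R$ to $R$, $\delta_i$ an $\alpha_i$-derivation mapping $R$ to $R$) such that $\alpha_j\delta_i=\delta_i\alpha_j$ for $i\ne j$, $\alpha_i\alpha_j=\alpha_j\alpha_i$, $\delta_i\delta_j=\delta_j\delta_i$, and $\alpha_j(Y_i)=Y_i$, $\delta_j(Y_i)=0$ for $i<j$. Its multiplication is $\star$. It is a free left $R$-module on the set of terms $\mathcal T=\{Y_1^{a_1}\cdots Y_n^{a_n}\}$, a commutative monoid. For $\tau=Y_1^{a_1}\cdots Y_n^{a_n}$ put $\alpha_\tau=\alpha_1^{a_1}\cdots\alpha_n^{a_n}:R\to R$. The associated graded Ore extension $\mathsf S=R[Y_1;\alpha_1]\cdots[Y_n;\alpha_n]$ is the same left $R$-module with multiplication $\ast$ determined by $(a\tau)\ast(b\omega)=a\,\alpha_\tau(b)\,\tau\omega$. **Orderings.** $\mathsf R^m$ has canonical basis $\mathbf e_1,\dots,\mathbf e_m$ and terms $\mathcal T^{(m)}=\{t\mathbf e_i\}$; $\tau\mathbf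 e_i\mid\omega\mathbf e_j$ means $i=j$ and $\tau\mid\omega$. Fix a term ordering $\prec$ on $\mathcal T$ and a compatible term ordering $<$ on $\mathcal T^{(m)}$: a well-ordering with $\omega_1\prec\omega_2\Rightarrow\omega_1t<\omega_2t$ and $t_1<t_2\Rightarrow\omega t_1<\omega t_2$. $\mathbf T(f)$, $\mathrm{lc}(f)$ and $\mathbf M(f)=\mathrm{lc}(f)\mathbf T(f)$ are maximal term, leading coefficient and maximal monomial. **Gröbner notions.** $F$ is a left (weak) Gröbner basis of the left module $\mathsf M$ it generates if for every $f\in\mathsf M\setminus\{0\}$ one has $\mathbf M(f)=\sum_ia_i\lambda_i\ast\mathbf M(g_{j_i})$ with $a_i\in R\setminus\{0\}$, $\lambda_i\in\mathcal T$, $\lambda_i\mathbf T(g_{j_i})=\mathbf T(f)$. A left Gröbner representation of $f$ is $f=\sum_il_i\star g_i$ with $l_i\in\mathsf R$ and $\mathbf T(l_i)\mathbf T(g_i)\le\mathbf T(f)$ whenever $l_i\ne0$ (the zero element has the trivial representation). **Gebauer–Möller sets.** Let $e_1,\dots,e_u$ be the canonical basis of $\mathsf S^u$ and $\mathfrak s_L:\mathsf S^u\to\mathsf S^m$, $\mathfrak s_L(\sum h_ie_i)=\sum h_i\ast\mathbf M(g_i)$. An element $\sum a_i\lambda_ie_i$ ($a_i\in R,\lambda_i\in\mathcal T$) is $\mathcal T^{(m)}$-homogeneous if $\lambda_i\mathbf T(g_i)$ is the same term for all $i$ with $a_i\ne0$ (zero is allowed as an element of a generating set). A left Gebauer–Möller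 set for $F$ is a set of $\mathcal T^{(m)}$-homogeneous generators of the left $\mathsf S$-module $\ker(\mathfrak s_L)$. **Zacharias ring.** A ring $R$ with identity is a left Zacharias ring if (a) it is noetherian; (b) there is an algorithm which, given $c\in R^m$ and a finite $C=\{c_1,\dots,c_t\}\subset R^m\setminus\{0\}$, decides whether $c$ lies in the left module generated by $C$ and, if so, produces $d_i\in R$ with $c=\sum d_ic_i$; (c) there is an algorithm which, given $\{c_1,\dots,c_t\}\subset R^m\setminus\{0\}$, computes a finite set of generators of the left syzygy module $\{(d_1,\dots,d_t)\in R^t:\sum d_ic_i=0\}$. *)

(* Defs.v *)
From HB Require Import structures.
From mathcomp Require Import all_boot all_order all_algebra.
From mathcomp Require Import bigenough ssrcomplements.
From mathcomp Require Export mpoly.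

Set Implicit Arguments.
Unset Strict Implicit.
Unset Printing Implicit Defensive.

Import GRing.Theory BigEnough.
Local Open Scope ring_scope.

(** * Left modules *)

Definition lspan (A : nzRingType) (V : lmodType A) (P : V -> Prop) (x : V) :
    Prop :=
  exists s : seq (A * V),
    (forall p, p \in s -> P p.2) /\ x = \sum_(p <- s) p.1 *: p.2.

Definition generates (A : nzRingType) (V : lmodType A) (P M : V -> Prop) :
    Prop :=
  forall x, M x <-> lspan P x.

Definition left_noetherian (R : nzRingType) : Prop :=
  forall I : R^o -> Prop,
    I 0 -> (forall x y, I x -> I y -> I (x + y)) ->
    (forall (a : R) x, I x -> I (a *: x)) ->
  exists B : seq R^o, generates (fun x => x \in B) I.

(** The two algorithms are carried as functions: the record lives in [Type],
    and its fields return the decision, the coefficients and the generators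
    themselves.  "Noetherian" is read on the left, like all the rest. *)
Record left_zacharias (R : nzRingType) : Type := LeftZacharias {
  zacharias_noetherian : left_noetherian R;
  zacharias_membership :
    forall (m t : nat) (C : 'I_t -> 'rV[R]_m) (c : 'rV[R]_m),
    (forall i, C i != 0) ->
    {d : 'I_t -> R | c = \sum_i d i *: C i}
      + {~ lspan (fun x => exists i, x = C i) c};
  zacharias_syzygies :
    forall (m t : nat) (C : 'I_t -> 'rV[R]_m),
    (forall i, C i != 0) ->
    {B : seq 'rV[R]_t |
      generates (fun d => d \in B) (fun d => \sum_i d 0 i *: C i = 0)} }.

(** * Multivariate Ore extensions *)

(** Each [alpha i] and [delta i] is given by its restriction to [R]; on terms
    they are prescribed by alpha_j(Y_i) = Y_i and delta_j(Y_i) = 0, so on the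
    whole extension they act coefficientwise. *)
Record ore_data (n : nat) (R : nzRingType) : Type := OreData {
  alpha : 'I_n -> {rmorphism R -> R};
  delta : 'I_n -> {additive R -> R};
  alpha_inj : forall i, injective (alpha i);
  delta_der : forall i a b,
    delta i (a * b) = alpha i a * delta i b + delta i a * b;
  alphaC : forall i j r, alpha i (alpha j r) = alpha j (alpha i r);
  deltaC : forall i j r, delta i (delta j r) = delta j (delta i r);
  alpha_deltaC : forall i j, i != j ->
    forall r, alpha j (delta i r) = delta i (alpha j r) }.

(** A term Y_1^a_1 ... Y_n^a_n is its exponent vector in 'X_{1..n}, so products,
    divisibility, quotients and lcms of terms are [+], [<=], [-] and [mlcm].
    The carrier of R[Y_1; alpha_1, delta_1]...[Y_n; alpha_n, delta_n] is the
    left R-module {mpoly R[n]}, free on the terms; its product as a polynomial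
    ring is used only to shift exponents.  The Ore product is the ring
    structure put on [ore D] below; lemmas [ore_XM] and [ore_XX] are the
    relations that determine it. *)
Definition ore (n : nat) (R : nzRingType) (D : ore_data n R) : Type :=
  {mpoly R[n]}.

HB.instance Definition _ n R (D : ore_data n R) :=
  GRing.Lmodule.copy (ore D) {mpoly R[n]}.

Section OreRing.
Variables (n : nat) (R : nzRingType) (D : ore_data n R).
Implicit Types (f g h : {mpoly R[n]}) (t : 'X_{1..n}) (r : R).

(** f |-> alpha_i(f) Y_i + delta_i(f), the left multiplication by Y_i. *)
Definition ore_var (i : 'I_n) f : {mpoly R[n]} :=
  'X_i * map_mpoly (alpha D i) f + map_mpoly (delta D i) f.

(** Left multiplication by Y_1^(t 1) ... Y_n^(t n). *)
Definition ore_term t f : {mpoly R[n]} :=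
  foldr (fun i h => iter (t i) (ore_var i) h) f (enum 'I_n).

Definition ore_mul (f g : ore D) : ore D :=
  \sum_(t <- msupp f) f@_t *: ore_term t g.

(** alpha_t = alpha_1^(t 1) ... alpha_n^(t n) *)
Definition alpha_term t r : R :=
  foldr (fun i b => iter (t i) (alpha D i) b) r (enum 'I_n).

Definition ore_one : ore D := 1 : {mpoly R[n]}.

Lemma map_mpoly_addZX (phi : {additive R -> R}) r t :
  map_mpoly phi (r *: 'X_[t] : {mpoly R[n]}) = phi r *: 'X_[t].
Proof.
apply/mpolyP=> k; rewrite mcoeff_map_mpoly !mcoeffZ !mcoeffX.
by case: eqP => _; rewrite ?mulr1 // !mulr0 raddf0.
Qed.

Lemma mpolyX_scale t r f : 'X_[t] * (r *: f) = r *: ('X_[t] * f).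
Proof. by rewrite -!commr_mpolyX scalerAl. Qed.

Lemma map_mpoly_addXM (phi : {additive R -> R}) t f :
  map_mpoly phi ('X_[t] * f) = 'X_[t] * map_mpoly phi f.
Proof.
rewrite [f]mpolyE mulr_sumr !raddf_sum /= mulr_sumr; apply: eq_bigr => k _.
by rewrite mpolyX_scale -mpolyXD !map_mpoly_addZX mpolyX_scale -mpolyXD.
Qed.

Lemma ore_var_is_additive i : additive (ore_var i).
Proof.
by move=> f g; rewrite /ore_var !raddfB /= mulrBr opprD !addrA; congr (_ + _);
   rewrite addrAC.
Qed.

HB.instance Definition _ i :=
  GRing.isAdditive.Build {mpoly R[n]} {mpoly R[n]} (ore_var i)
    (ore_var_is_additive i).

Lemma ore_varZ i r f :
  ore_var i (r *: f) = alpha D i r *: ore_var i f + delta D i r *: f.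
Proof.
rewrite /ore_var.
have -> : map_mpoly (delta D i) (r *: f)
    = alpha D i r *: map_mpoly (delta D i) f + delta D i r *: f.
  apply/mpolyP=> k; rewrite mcoeffD !mcoeffZ !mcoeff_map_mpoly mcoeffZ.
  exact: delta_der.
by rewrite map_mpolyZ mpolyX_scale scalerDr addrA.
Qed.

Lemma ore_varX i t : ore_var i 'X_[t] = 'X_[U_(i) + t].
Proof.
rewrite /ore_var map_mpolyX -mpolyXD -['X_[t]]scale1r map_mpoly_addZX.
suff -> : delta D i 1 = 0 by rewrite scale0r addr0.
have := delta_der D i 1 1; rewrite !mulr1 rmorph1 mul1r => /eqP.
by rewrite addrC -subr_eq subrr eq_sym => /eqP.
Qed.

Lemma ore_varC i j f : ore_var i (ore_var j f) = ore_var j (ore_var i f).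
Proof.
case: (eqVneq i j) => [->//|nij].
rewrite /ore_var !raddfD /= !map_mpoly_addXM !mulrDr !mulrA.
rewrite -['X_i * 'X_j]mpolyXD -['X_j * 'X_i]mpolyXD addmC.
have -> : map_mpoly (alpha D i) (map_mpoly (alpha D j) f)
        = map_mpoly (alpha D j) (map_mpoly (alpha D i) f).
  by apply/mpolyP=> k; rewrite !mcoeff_map_mpoly /= alphaC.
have -> : map_mpoly (delta D i) (map_mpoly (delta D j) f)
        = map_mpoly (delta D j) (map_mpoly (delta D i) f).
  by apply/mpolyP=> k; rewrite !mcoeff_map_mpoly /= deltaC.
have -> : map_mpoly (alpha D i) (map_mpoly (delta D j) f)
        = map_mpoly (delta D j) (map_mpoly (alpha D i) f).
  by apply/mpolyP=> k; rewrite !mcoeff_map_mpoly /= alpha_deltaC // eq_sym.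
have -> : map_mpoly (alpha D j) (map_mpoly (delta D i) f)
        = map_mpoly (delta D i) (map_mpoly (alpha D j) f).
  by apply/mpolyP=> k; rewrite !mcoeff_map_mpoly /= alpha_deltaC.
by rewrite -!addrA; congr (_ + _); rewrite addrCA.
Qed.

Lemma ore_term_is_additive t : additive (ore_term t).
Proof.
rewrite /ore_term; elim: (enum 'I_n) => [|i s IHs] f g //=.
by rewrite IHs; elim: (t i) => [|k IHk] //=; rewrite IHk raddfB.
Qed.

HB.instance Definition _ t :=
  GRing.isAdditive.Build {mpoly R[n]} {mpoly R[n]} (ore_term t)
    (ore_term_is_additive t).

Lemma ore_termU i t f : ore_term (U_(i) + t) f = ore_var i (ore_term t f).
Proof.
have iterC j k h :
    iter k (ore_var j) (ore_var i h) = ore_var i (iter k (ore_var j) h).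
  by elim: k => //= k ->; rewrite ore_varC.
have notin s : i \notin s ->
    foldr (fun j h => iter ((U_(i) + t)%MM j) (ore_var j) h) f s
    = foldr (fun j h => iter (t j) (ore_var j) h) f s.
  elim: s => //= j s IHs; rewrite inE negb_or => /andP[nij /IHs ->].
  by rewrite mnmDE mnm1E (negbTE nij).
rewrite /ore_term; have := mem_enum 'I_n i; have := enum_uniq 'I_n.
rewrite inE; elim: (enum 'I_n) => //= j s IHs /andP[njs us].
rewrite inE mnmDE mnm1E; case: eqVneq => [eij _|_ /= /(IHs us) ->].
  by rewrite eij in notin *; rewrite notin.
by rewrite iterC.
Qed.

Lemma ore_term0 f : ore_term 0 f = f.
Proof.
rewrite /ore_term; elim: (enum 'I_n) => //= i s ->.
by rewrite mnm0E.
Qed.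

Lemma mnm_ind (P : 'X_{1..n} -> Prop) :
  P 0%MM -> (forall i t, P t -> P (U_(i) + t)%MM) -> forall t, P t.
Proof.
move=> P0 PS t; elim: {t}(mdeg t) {-2}t (erefl (mdeg t)) => [|d IHd] t dt.
  by move/eqP: dt; rewrite mdeg_eq0 => /eqP->.
have /existsP[i ti] : [exists i, t i != 0%N].
  rewrite -negb_forall; apply/negP => /forallP t0.
  have : mdeg t == 0%N.
    by rewrite mdeg_eq0; apply/eqP/mnmP=> i; rewrite mnm0E; apply/eqP/t0.
  by rewrite dt.
have e : (U_(i) + (t - U_(i)))%MM = t by rewrite addmC submK // lep1mP.
rewrite -e; apply: PS; apply: IHd; apply/eqP.
by rewrite -(eqn_add2l 1) -{1}(mdeg1 i) -mdegD e dt.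
Qed.

Lemma ore_termX t s : ore_term t 'X_[s] = 'X_[t + s].
Proof.
elim/mnm_ind: t => [|i t IHt]; first by rewrite ore_term0 add0m.
by rewrite ore_termU IHt ore_varX addmA.
Qed.

Lemma ore_mulE (f g : ore D) k : (msize (f : {mpoly R[n]}) <= k)%N ->
  ore_mul f g
    = \sum_(t : 'X_{1..n < k}) (f : {mpoly R[n]})@_t *: ore_term t g.
Proof.
move=> le_fk; pose I : subFinType _ := 'X_{1..n < k}.
rewrite /ore_mul (big_mksub I) ?msupp_uniq //=; first last.
  by move=> x /msize_mdeg_lt /leq_trans; apply.
by rewrite big_rmcond //= => j /memN_msupp_eq0 ->; rewrite scale0r.
Qed.

Lemma ore_mulDl : left_distributive ore_mul +%R.
Proof.
move=> f g h; pose_big_enough k.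
  rewrite !(@ore_mulE _ _ k) // -big_split; apply: eq_bigr => t _ /=.
  by rewrite -scalerDl -mcoeffD.
by close.
Qed.

Lemma ore_mulDr : right_distributive ore_mul +%R.
Proof.
move=> f g h; rewrite /ore_mul -big_split; apply: eq_bigr => t _ /=.
by rewrite -scalerDr -raddfD.
Qed.

Lemma ore_mul0l h : ore_mul (0 : {mpoly R[n]}) h = 0.
Proof. by rewrite /ore_mul msupp0 big_nil. Qed.

Lemma ore_mulZl r (f g : {mpoly R[n]}) :
  ore_mul (r *: f : {mpoly R[n]}) g = r *: (ore_mul f g : {mpoly R[n]}).
Proof.
pose_big_enough k.
  rewrite !(@ore_mulE _ _ k) // scaler_sumr; apply: eq_bigr => t _ /=.
  by rewrite mcoeffZ scalerA.
by close.
Qed.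

Lemma ore_mulXl t (f : {mpoly R[n]}) :
  ore_mul ('X_[t] : {mpoly R[n]}) f = ore_term t f.
Proof. by rewrite /ore_mul msuppX big_seq1 mcoeffX eqxx scale1r. Qed.

Lemma ore_mul_var i f g : ore_mul (ore_var i f) g = ore_var i (ore_mul f g).
Proof.
elim/mpolyind: f => [|c t f _ _ IHf]; first by rewrite raddf0 !ore_mul0l raddf0.
rewrite (raddfD (ore_var i)) /= (ore_mulDl (ore_var i (c *: 'X_[t]))) IHf.
rewrite (ore_mulDl (c *: 'X_[t])) (raddfD (ore_var i)) /=; congr (_ + _).
rewrite ore_varZ ore_varX (ore_mulDl (_ *: 'X_[_])) !ore_mulZl !ore_mulXl.
by rewrite ore_varZ ore_termU.
Qed.

Lemma ore_mulA : associative ore_mul.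
Proof.
move=> f g h; elim/mpolyind: f => [|c t f _ _ IHf]; first by rewrite !ore_mul0l.
rewrite !ore_mulDl IHf; congr (_ + _); rewrite !ore_mulZl; congr (_ *: _).
rewrite !ore_mulXl; elim/mnm_ind: t => [|i t IHt]; first by rewrite !ore_term0.
by rewrite !ore_termU IHt ore_mul_var.
Qed.

Lemma ore_mul1l : left_id ore_one ore_mul.
Proof. by move=> f; rewrite /ore_one -mpolyX0 ore_mulXl ore_term0. Qed.

Lemma ore_mul1r : right_id ore_one ore_mul.
Proof.
move=> f; rewrite [RHS]mpolyE; apply: eq_bigr => t _.
by rewrite /ore_one -mpolyX0 ore_termX addm0.
Qed.

Lemma ore_one_neq0 : ore_one != 0.
Proof. exact: (oner_neq0 {mpoly R[n]}). Qed.

HB.instance Definition _ := GRing.Zmodule_isNzRing.Build (ore D)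
  ore_mulA ore_mul1l ore_mul1r ore_mulDl ore_mulDr ore_one_neq0.

Definition oreX t : ore D := 'X_[t] : {mpoly R[n]}.

Definition ore_coef (f : ore D) t : R := (f : {mpoly R[n]})@_t.

Definition ore_supp (f : ore D) : seq 'X_{1..n} := msupp (f : {mpoly R[n]}).

Lemma ore_mulXr (f : {mpoly R[n]}) t : (f : ore D) * oreX t = f * 'X_[t].
Proof.
rewrite [in RHS](mpolyE f) mulr_suml; apply: eq_bigr => s _.
by rewrite ore_termX -scalerAl -mpolyXD.
Qed.

(** Y_i * f = alpha_i(f) Y_i + delta_i(f) on the whole extension, for the
    coefficientwise [alpha i] and [delta i]. *)
Lemma ore_XM i (f : {mpoly R[n]}) :
  oreX U_(i) * (f : ore D)
    = (map_mpoly (alpha D i) f : ore D) * oreX U_(i)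
      + (map_mpoly (delta D i) f : ore D).
Proof.
rewrite ore_mulXr commr_mpolyX [LHS]ore_mulXl.
by rewrite -{1}[U_(i)%MM]addm0 ore_termU ore_term0.
Qed.

Lemma ore_XX t s : oreX t * oreX s = oreX (t + s).
Proof. by rewrite [LHS]ore_mulXl ore_termX. Qed.

End OreRing.

Arguments oreX {n R D} t%_MM.

(** The associated graded extension S = R[Y_1; alpha_1]...[Y_n; alpha_n]. *)
Section Graded.
Variables (n : nat) (R : nzRingType) (D : ore_data n R).

Let null : {additive R -> R} := \0.

Fact graded_der i (a b : R) :
  null (a * b) = alpha D i a * null b + null a * b.
Proof. by rewrite /null /= mulr0 mul0r addr0. Qed.

Fact graded_comm (i j : 'I_n) :
  i != j -> forall r, alpha D j (null r) = null (alpha D j r).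
Proof. by move=> _ r; rewrite /null /= rmorph0. Qed.

Definition graded : ore_data n R :=
  @OreData n R (alpha D) (fun=> null) (@alpha_inj n R D) graded_der
    (@alphaC n R D) (fun _ _ _ => erefl) graded_comm.

Lemma graded_mulE (a b : R) (t s : 'X_{1..n}) :
  (a *: oreX t : ore graded) * (b *: oreX s)
    = (a * alpha_term D t b) *: oreX (t + s).
Proof.
rewrite [LHS]ore_mulZl ore_mulXl -scalerA; congr (_ *: _).
have varE i c k : ore_var graded i (c *: 'X_[k]) = alpha D i c *: 'X_[U_(i) + k].
  by rewrite ore_varZ ore_varX [delta _ _ _]/= scale0r addr0.
have iterE i d c k : iter d (ore_var graded i) (c *: 'X_[k])
    = iter d (alpha D i) c *: 'X_[U_(i) *+ d + k].
  elim: d => [|d IHd] /=; first by rewrite mulm0n add0m.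
  by rewrite IHd varE addmA mulmS.
have foldE l c k :
    foldr (fun i h => iter (t i) (ore_var graded i) h) (c *: 'X_[k]) l
    = foldr (fun i x => iter (t i) (alpha D i) x) c l
        *: 'X_[\sum_(i <- l) U_(i) *+ t i + k].
  elim: l => [|i l IHl] /=; first by rewrite big_nil add0m.
  by rewrite IHl iterE big_cons addmA.
rewrite /ore_term foldE /alpha_term; congr (_ *: 'X_[_ + s]).
by rewrite big_enum [RHS]multinomUE_id.
Qed.

Definition ungraded (f : ore graded) : ore D := f.

End Graded.

(** * Terms and orderings *)

(** The term t e_i of the free module of rank m is the pair (t, i). *)
Definition mterm (n m : nat) : Type := ('X_{1..n} * 'I_m)%type.

HB.instance Definition _ n m := Choice.on (mterm n m).

Definition tmul n m (s : 'X_{1..n}) (t : mterm n m) : mterm n m :=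
  ((s + t.1)%MM, t.2).

Definition tdvd n m (s t : mterm n m) : bool :=
  (s.2 == t.2) && (s.1 <= t.1)%MM.

Definition well_order (T : eqType) (lt : rel T) : Prop :=
  [/\ irreflexive lt, transitive lt, forall x y, x != y -> lt x y || lt y x
    & well_founded lt].

Definition term_order n (prec : rel 'X_{1..n}) : Prop :=
  well_order prec /\
  forall s t1 t2, prec t1 t2 -> prec (s + t1)%MM (s + t2)%MM.

Definition module_term_order n m (prec : rel 'X_{1..n})
    (lt : rel (mterm n m)) : Prop :=
  [/\ well_order lt,
      forall s1 s2 t, prec s1 s2 -> lt (tmul s1 t) (tmul s2 t)
    & forall s t1 t2, lt t1 t2 -> lt (tmul s t1) (tmul s t2)].

(** [None] exactly on the empty sequence. *)
Definition seq_max (T : Type) (lt : rel T) (s : seq T) : option T :=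
  foldr (fun x acc => if acc is Some y then Some (if lt x y then y else x)
                      else Some x) None s.

Section Leading.
Variables (n : nat) (R : nzRingType) (D : ore_data n R) (m : nat).
Variable lt : rel (mterm n m).
Implicit Types (f : 'rV[ore D]_m).

Definition ore_maxterm (prec : rel 'X_{1..n}) (h : ore D) :
    option 'X_{1..n} :=
  seq_max prec (ore_supp h).

Definition vsupp f : seq (mterm n m) :=
  [seq (t, i) | i <- enum 'I_m, t <- ore_supp (f 0 i)].

(** T(f), with [None] standing for the undefined T(0). *)
Definition maxterm f : option (mterm n m) := seq_max lt (vsupp f).

Definition lcoef f : R :=
  if maxterm f is Some t then ore_coef (f 0 t.2) t.1 else 0.

End Leading.

(** The monomial c t e_i. *)
Definition mmon n (R : nzRingType) (D : ore_data n R) m (c : R)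
    (t : 'X_{1..n}) (i : 'I_m) : 'rV[ore D]_m :=
  (c *: oreX t : ore D) *: delta_mx 0 i.

(** M(f) is an element of the free module over the graded extension. *)
Definition maxmon n (R : nzRingType) (D : ore_data n R) m
    (lt : rel (mterm n m)) (f : 'rV[ore D]_m) : 'rV[ore (graded D)]_m :=
  if maxterm lt f is Some t then mmon (graded D) (lcoef lt f) t.1 t.2 else 0.

(** * Groebner bases and Gebauer-Moeller sets *)

Section Groebner.
Variables (n : nat) (R : nzRingType) (D : ore_data n R) (m u : nat).
Variables (prec : rel 'X_{1..n}) (lt : rel (mterm n m)).
Variable g : 'I_u -> 'rV[ore D]_m.

Definition left_groebner_basis : Prop :=
  forall f, lspan (fun x => exists i, x = g i) f -> f != 0 ->
  exists s : seq (R * 'X_{1..n} * 'I_u),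
    (forall p, p \in s ->
       p.1.1 != 0 /\ omap (tmul p.1.2) (maxterm lt (g p.2)) = maxterm lt f) /\
    maxmon lt f
      = \sum_(p <- s) (p.1.1 *: oreX p.1.2 : ore (graded D))
                        *: maxmon lt (g p.2).

Definition left_groebner_rep (f : 'rV[ore D]_m) : Prop :=
  exists l : 'I_u -> ore D,
    f = \sum_i l i *: g i /\
    forall i, l i != 0 ->
      exists a t s, [/\ ore_maxterm prec (l i) = Some a,
        maxterm lt (g i) = Some t, maxterm lt f = Some s
        & (tmul a t == s) || lt (tmul a t) s].

Definition homogeneous (h : 'rV[ore (graded D)]_u) : Prop :=
  exists (a : 'I_u -> R) (t : 'I_u -> 'X_{1..n}),
    h = \row_i (a i *: oreX (t i) : ore (graded D)) /\
    forall i j, a i != 0 -> a j != 0 ->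
      omap (tmul (t i)) (maxterm lt (g i))
        = omap (tmul (t j)) (maxterm lt (g j)).

Definition syzygy_map (h : 'rV[ore (graded D)]_u) : 'rV[ore (graded D)]_m :=
  \sum_i h 0 i *: maxmon lt (g i).

Definition gebauer_moeller_set (P : 'rV[ore (graded D)]_u -> Prop) : Prop :=
  (forall h, P h -> homogeneous h) /\ generates P (fun h => syzygy_map h = 0).

End Groebner.

(** In this section M(g_i) = c_i tau_i e_(l i). *)
Section Syzygies.
Variables (n : nat) (R : nzRingType) (D : ore_data n R) (m u : nat).
Variables (c : 'I_u -> R) (tau : 'I_u -> 'X_{1..n}) (l : 'I_u -> 'I_m).

Definition lcm_term (e : mterm n m) : Prop :=
  exists H : {set 'I_u},
    [/\ H != set0, forall i, i \in H -> l i = e.2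
      & e.1 = \big[@mlcm n/0%MM]_(i in H) tau i].

Definition quot_term (e : mterm n m) (i : 'I_u) : ore (graded D) :=
  if tdvd (tau i, l i) e then oreX (e.1 - tau i) else 0.

Definition quot_coef (e : mterm n m) (i : 'I_u) : R :=
  if tdvd (tau i, l i) e then alpha_term D (e.1 - tau i) (c i) else 0.

Definition syzygy_set (C : mterm n m -> seq 'rV[R]_u)
    (sigma : 'rV[ore (graded D)]_u) : Prop :=
  exists e d, [/\ lcm_term e, d \in C e
    & sigma = \row_i (d 0 i *: quot_term e i)].

End Syzygies.

(* Main.v *)
(** Give the generator e_i the weight T(g_i).  The component of degree e of an
    element of ker s_L is, after division by e/m with m the lcm of the tau_i
    dividing e, a syzygy of the v(m)_i over R: this uses that alpha_(e/m) is
    surjective to pull the coefficients back.  Hence S(F), and then S'(F),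
    generates the kernel degree by degree.

    The products of the Ore extension and of its graded ring differ by strictly
    smaller terms.  So if f = sum x_i g_i with x of weight at most e and the
    coefficient of e in f vanishes, the component of degree e of x is a graded
    syzygy, and the representations of the elements of R(F) turn it into a
    vector of weight strictly below e with the same image.  Well-founded
    induction on e then gives a representation of f whose top degree is T(f). *)
From HB Require Import structures.
Require Import Defs.
From Stdlib Require Import Classical_Prop.
From mathcomp Require Import all_boot all_order all_algebra.

Set Implicit Arguments.
Unset Strict Implicit.
Unset Printing Implicit Defensive.

Import GRing.Theory.
Local Open Scope ring_scope.

Lemma seq_max_mem (T : eqType) (lt : rel T) (s : seq T) x :
  seq_max lt s = Some x -> x \in s.
Proof.
elim: s x => //= y s IHs x; case: (seq_max lt s) IHs => [z|] IHs [<-].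
  by case: ifP => _; rewrite inE ?eqxx // IHs ?orbT.
by rewrite inE eqxx.
Qed.

Lemma seq_max_ge (T : eqType) (lt : rel T) (s : seq T) x :
  well_order lt -> seq_max lt s = Some x ->
  forall y, y \in s -> (y == x) || lt y x.
Proof.
case=> _ tr tot _; elim: s x => //= y s IHs x.
case e: (seq_max lt s) => [z|] [<-] w; rewrite inE; last first.
  by case: s e {IHs} => [|? ?] /=; [rewrite orbF => _ -> | case: (seq_max _ _)].
case/predU1P=> [->|/(IHs _ e)].
  case: ifP => lyz; first by rewrite lyz orbT.
  by rewrite eqxx.
case: ifP => // lyz /orP[/eqP->|lwz].
  case: eqVneq => //= zy; move: (tot _ _ zy); rewrite lyz orbF.
  by [].
apply/orP; right; case: (eqVneq z y) => [<-//|zy].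
by move: (tot _ _ zy); rewrite lyz orbF; apply: tr.
Qed.

Lemma seq_max_None (T : Type) (lt : rel T) (s : seq T) :
  seq_max lt s = None -> s = [::].
Proof. by case: s => //= x s; case: (seq_max lt s). Qed.

Lemma seq_maxP (T : eqType) (lt : rel T) (s : seq T) x : well_order lt ->
  x \in s -> (forall y, y \in s -> (y == x) || lt y x) ->
  seq_max lt s = Some x.
Proof.
move=> wo xs xmax; case e: (seq_max lt s) => [z|]; last first.
  by rewrite (seq_max_None e) in xs.
congr Some; have := xmax z (seq_max_mem e); have := seq_max_ge wo e xs.
case: wo => ir tr _ _; case/orP=> [/eqP//|lxz] /orP[/eqP//|lzx].
by have := ir x; rewrite (tr _ _ _ lxz lzx).
Qed.

Lemma lem0m n (t : 'X_{1..n}) : (0 <= t)%MM.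
Proof. by apply/mnm_lepP=> i; rewrite mnm0E. Qed.

Lemma lem_big_mlcm n (I : finType) (P : pred I) (F : I -> 'X_{1..n}) t :
  (\big[@mlcm n/0%MM]_(i | P i) F i <= t)%MM = [forall (i | P i), (F i <= t)%MM].
Proof.
rewrite (big_morph (fun s => s <= t)%MM (id1 := true) (op1 := andb)) ?big_andE //.
  by move=> ? ?; apply: lem_mlcm.
exact: lem0m.
Qed.

Lemma mcoeffXM n (R : nzRingType) (s t : 'X_{1..n}) (f : {mpoly R[n]}) :
  ('X_[s] * f)@_t = if (s <= t)%MM then f@_(t - s) else 0.
Proof.
rewrite -commr_mpolyX; case: ifP => [st|nst].
  by rewrite -{1}(submK st) addmC mcoeffMX.
apply/memN_msupp_eq0; rewrite (perm_mem (msuppMX _ _)).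
by apply/mapP => -[k _ e]; rewrite e lem_addr in nst.
Qed.

Lemma term_order_gt0 n (prec : rel 'X_{1..n}) i :
  term_order prec -> prec 0%MM U_(i)%MM.
Proof.
case=> -[ir tr tot wf] mon; have nz : (0 : 'X_{1..n})%MM != U_(i)%MM.
  by rewrite eq_sym mnm1_eq0.
case/orP: (tot _ _ nz) => // lt0; exfalso.
suff H t : ~ exists k, t = (U_(i) *+ k)%MM by apply: (H 0%MM); exists 0%N.
elim/(well_founded_ind wf): t => t IHt [k tE].
apply: (IHt (U_(i) *+ k.+1)%MM); last by exists k.+1.
by rewrite tE mulmSr -{2}[(U_(i) *+ k)%MM]addm0; apply: mon.
Qed.

Section AlphaTerm.
Variables (n : nat) (R : nzRingType) (D : ore_data n R).

Lemma graded_ore_termZX t a s :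
  ore_term (graded D) t (a *: 'X_[s]) = alpha_term D t a *: 'X_[t + s].
Proof.
have := @graded_mulE n R D 1 a t s; rewrite scale1r mul1r => <-.
by rewrite [RHS]ore_mulXl.
Qed.

Lemma alpha_term0 a : alpha_term D 0 a = a.
Proof.
have /(congr1 (mcoeff (0 + 0)%MM)) := graded_ore_termZX 0 a 0%MM.
by rewrite ore_term0 !mcoeffZ addm0 mcoeffX eqxx !mulr1.
Qed.

Lemma graded_ore_varZX i a s :
  ore_var (graded D) i (a *: 'X_[s]) = alpha D i a *: 'X_[U_(i) + s].
Proof. by rewrite ore_varZ ore_varX [delta _ _ _]/= scale0r addr0. Qed.

Lemma alpha_termU i t a : alpha_term D (U_(i) + t) a = alpha D i (alpha_term D t a).
Proof.
have /(congr1 (mcoeff (U_(i) + t)%MM)) := graded_ore_termZX (U_(i) + t) a 0%MM.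
rewrite ore_termU graded_ore_termZX graded_ore_varZX !addm0 !mcoeffZ mcoeffX.
by rewrite eqxx !mulr1.
Qed.

Lemma alpha_termA s t a : alpha_term D (s + t) a = alpha_term D s (alpha_term D t a).
Proof.
elim/mnm_ind: s => [|i s IHs]; first by rewrite add0m alpha_term0.
by rewrite -addmA !alpha_termU IHs.
Qed.

Lemma alpha_termM t a b : alpha_term D t (a * b) = alpha_term D t a * alpha_term D t b.
Proof.
elim/mnm_ind: t => [|i s IHs]; first by rewrite !alpha_term0.
by rewrite !alpha_termU IHs rmorphM.
Qed.

Lemma alpha_term_is_additive t : additive (alpha_term D t).
Proof.
move=> a b; elim/mnm_ind: t => [|i s IHs]; first by rewrite !alpha_term0.
by rewrite !alpha_termU IHs raddfB.
Qed.

HB.instance Definition _ t :=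
  GRing.isAdditive.Build R R (alpha_term D t) (alpha_term_is_additive t).

Lemma alpha_term_bij t :
  (forall i, bijective (alpha D i)) -> bijective (alpha_term D t).
Proof.
move=> bij; elim/mnm_ind: t => [|i t IHt].
  by exists id => a; rewrite alpha_term0.
by apply: (eq_bij (bij_comp (bij i) IHt)) => a; rewrite alpha_termU.
Qed.

Lemma graded_ore_termE t f s :
  (ore_term (graded D) t f)@_s
    = if (t <= s)%MM then alpha_term D t f@_(s - t) else 0.
Proof.
rewrite [f]mpolyE raddf_sum /= !raddf_sum /=.
under eq_bigr => k _ do rewrite graded_ore_termZX mcoeffZ mcoeffX.
case: ifP => [ts|nts].
  apply: eq_bigr => k _.
  rewrite mcoeffZ mcoeffX -{1}(submK ts) addmC eqm_add2r.
  by case: eqP => _; rewrite ?mulr1 // !mulr0 raddf0.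
apply: big1 => k _; case: eqP => [e|_]; last by rewrite mulr0.
by rewrite -e lem_addr in nts.
Qed.

Lemma graded_mulmonE (f : ore (graded D)) c s t :
  (f * (c *: oreX s) : {mpoly R[n]})@_t
    = if (s <= t)%MM then (f : {mpoly R[n]})@_(t - s) * alpha_term D (t - s) c
      else 0.
Proof.
rewrite [X in X@_t]/(ore_mul f _) /ore_mul raddf_sum /=.
under eq_bigr => k _ do rewrite mcoeffZ graded_ore_termZX mcoeffZ mcoeffX.
case: ifP => [st|nst].
  rewrite (bigID (pred1 (t - s)%MM)) /= addrC big1 ?add0r; last first.
    move=> k /negbTE nk; case: eqP => [e|_]; last by rewrite !mulr0.
    by rewrite -e addmK eqxx in nk.
  have [kf|nkf] := boolP ((t - s)%MM \in msupp (f : {mpoly R[n]})).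
    rewrite -big_filter filter_pred1_uniq ?msupp_uniq //.
    by rewrite big_seq1 submK // eqxx mulr1.
  rewrite (memN_msupp_eq0 nkf) mul0r big1_seq // => k /andP[/eqP-> kf].
  by rewrite kf in nkf.
apply: big1 => k _; case: eqP => [e|_]; last by rewrite !mulr0.
by rewrite -e lem_addl in nst.
Qed.

End AlphaTerm.

Section Bounds.
Variables (n : nat) (R : nzRingType) (m : nat).
Variables (prec : rel 'X_{1..n}) (lt : rel (mterm n m)).
Hypothesis prec_order : term_order prec.
Hypothesis lt_order : module_term_order prec lt.
Implicit Types (b : bool) (e v w : mterm n m) (s t : 'X_{1..n}).
Implicit Types (f h : {mpoly R[n]}).

Let lt_wo : well_order lt. Proof. by case: lt_order. Qed.

Definition below b e : pred (mterm n m) := fun x => lt x e || b && (x == e).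

Lemma belowT e x : below true e x = (x == e) || lt x e.
Proof. by rewrite /below orbC. Qed.

Lemma belowF e x : below false e x = lt x e.
Proof. by rewrite /below orbF. Qed.

Lemma belowxx e : below true e e.
Proof. by rewrite belowT eqxx. Qed.

Lemma below_trans b1 b2 e x y :
  below b1 x y -> below b2 e x -> below (b1 && b2) e y.
Proof.
case: lt_wo => _ tr _ _; rewrite /below.
case/orP=> [lyx|/andP[-> /eqP->]] /orP[lxe|/andP[-> /eqP xe]].
- by rewrite (tr _ _ _ lyx lxe).
- by rewrite -xe lyx.
- by rewrite lxe.
- by rewrite xe eqxx orbT.
Qed.

Lemma tmul0 e : tmul 0%MM e = e.
Proof. by case: e => t i; rewrite /tmul add0m. Qed.

Lemma tmulA s t e : tmul (s + t)%MM e = tmul s (tmul t e).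
Proof. by rewrite /tmul /= addmA. Qed.

Lemma tmul_inj s : injective (@tmul n m s).
Proof.
move=> [t i] [t' i'] e; have /eqP := congr1 fst e; have /= -> := congr1 snd e.
by rewrite /= eqm_add2l => /eqP->.
Qed.

Lemma below_tmul b s e x : below b e x -> below b (tmul s e) (tmul s x).
Proof.
case: lt_order => _ _ mon; rewrite /below => /orP[lxe|/andP[-> /eqP->]].
  by rewrite (mon s _ _ lxe).
by rewrite eqxx orbT.
Qed.

Lemma lt_tmulU i e : lt e (tmul U_(i)%MM e).
Proof.
by case: lt_order => _ mon _; rewrite -{1}[e]tmul0; apply/mon/term_order_gt0.
Qed.

(* The terms of f e_i are smaller than e (or at most e, if [b]) when e_i is
   given the weight [v]. *)
Definition pbelow b e v f : Prop := forall t, f@_t != 0 -> below b e (tmul t v).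

Lemma pbelow0 b e v : pbelow b e v 0.
Proof. by move=> t; rewrite mcoeff0 eqxx. Qed.

Lemma pbelowD b e v f h : pbelow b e v f -> pbelow b e v h -> pbelow b e v (f + h).
Proof.
move=> bf bh t; have [f0|/bf//] := eqVneq f@_t 0.
by rewrite mcoeffD f0 add0r => /bh.
Qed.

Lemma pbelowZ b e v a f : pbelow b e v f -> pbelow b e v (a *: f).
Proof.
move=> bf t; have [f0|/bf//] := eqVneq f@_t 0.
by rewrite mcoeffZ f0 mulr0 eqxx.
Qed.

Lemma pbelowN b e v f : pbelow b e v f -> pbelow b e v (- f).
Proof. by rewrite -scaleN1r; apply: pbelowZ. Qed.

Lemma pbelow_sum b e v (I : eqType) (r : seq I) (F : I -> {mpoly R[n]}) :
  (forall i, i \in r -> pbelow b e v (F i)) -> pbelow b e v (\sum_(i <- r) F i).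
Proof.
move=> bF; rewrite big_seq.
by elim/big_ind: _ => //; [apply: pbelow0 | apply: pbelowD].
Qed.

Lemma pbelow_trans b1 b2 e x v f :
  pbelow b1 x v f -> below b2 e x -> pbelow (b1 && b2) e v f.
Proof. by move=> bf bx t /bf /below_trans; apply. Qed.

Section Ore.
Variable D : ore_data n R.

Lemma pbelow_var b e v i f :
  pbelow b e v f -> pbelow b (tmul U_(i)%MM e) v (ore_var D i f).
Proof.
move=> bf; apply: pbelowD => t.
  rewrite mcoeffXM mcoeff_map_mpoly /=; case: ifP => [it nz|_]; last by rewrite eqxx.
  rewrite -[t](submK it) addmC tmulA; apply: below_tmul; apply: bf.
  by apply: contraNneq nz => ->; rewrite raddf0.
rewrite mcoeff_map_mpoly => nz.
have /bf/below_trans/(_ (_ : below false _ _)) : f@_t != 0.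
  by apply: contraNneq nz => ->; rewrite raddf0.
move=> /(_ (tmul U_(i)%MM e)); rewrite belowF => /(_ (lt_tmulU _ _)).
by rewrite andbF belowF /below => ->.
Qed.

Lemma pbelow_term b e v s f :
  pbelow b e v f -> pbelow b (tmul s e) v (ore_term D s f).
Proof.
move=> bf; elim/mnm_ind: s => [|i s IHs]; first by rewrite tmul0 ore_term0.
by rewrite ore_termU tmulA; apply: pbelow_var.
Qed.
End Ore.

Lemma pbelow_varB D e v i f : pbelow true e v f ->
  pbelow false (tmul U_(i)%MM e) v (ore_var D i f - ore_var (graded D) i f).
Proof.
move=> bf; rewrite /ore_var opprD addrACA subrr add0r => t nz.
have ft : f@_t != 0.
  apply: contraNneq nz => f0.
  by rewrite mcoeffB !mcoeff_map_mpoly /= f0 raddf0 subrr.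
rewrite -[false]/(true && false); apply: below_trans (bf _ ft) _.
by rewrite belowF lt_tmulU.
Qed.

Lemma pbelow_termB D e v s f : pbelow true e v f ->
  pbelow false (tmul s e) v (ore_term D s f - ore_term (graded D) s f).
Proof.
move=> bf; elim/mnm_ind: s => [|i s IHs].
  by rewrite !ore_term0 subrr; apply: pbelow0.
rewrite !ore_termU tmulA.
rewrite -[X in X - _](subrK (ore_var (graded D) i (ore_term D s f))).
rewrite -addrA -raddfB; apply: pbelowD.
  by apply: pbelow_varB; apply: pbelow_term.
by apply: pbelow_var.
Qed.

Lemma pbelow_mul (D : ore_data n R) b e v w f h :
  pbelow b e v f -> pbelow true v w h -> pbelow b e w (@ore_mul n R D f h).
Proof.
move=> bf bh; apply: pbelow_sum => t; rewrite mcoeff_msupp => /bf bt.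
by apply: pbelowZ; rewrite -[b]andTb; apply: pbelow_trans bt; apply: pbelow_term.
Qed.

Lemma pbelow_mulB D e v w f h h' :
  pbelow true e v f -> pbelow true v w h -> pbelow false v w (h - h') ->
  pbelow false e w (@ore_mul n R D f h - @ore_mul n R (graded D) f h').
Proof.
move=> bf bh bh'; rewrite /ore_mul -sumrB; apply: pbelow_sum => t.
rewrite mcoeff_msupp => /bf bt; rewrite -scalerBr; apply: pbelowZ.
rewrite -[false]/(false && true); apply: pbelow_trans bt.
rewrite -[X in X - _](subrK (ore_term (graded D) t h)) -addrA -raddfB.
by apply: pbelowD; [apply: pbelow_termB | apply: pbelow_term].
Qed.

Lemma mem_vsupp (D : ore_data n R) (f : 'rV[ore D]_m) t (i : 'I_m) :
  ((t, i) \in vsupp f) = (ore_coef (f 0 i) t != 0).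
Proof.
apply/allpairsPdep/idP => [[j [s [_ + [-> ->]]]]|nz]; first by rewrite mcoeff_msupp.
by exists i, t; rewrite mem_enum mcoeff_msupp.
Qed.

Definition fbelow (D : ore_data n R) b e (f : 'rV[ore D]_m) : Prop :=
  forall j, pbelow b e (0%MM, j) (f 0 j).

Lemma tmul_unit t (j : 'I_m) : tmul t (0%MM, j) = (t, j).
Proof. by rewrite /tmul /= addm0. Qed.

Lemma maxterm_exists (D : ore_data n R) (f : 'rV[ore D]_m) :
  f != 0 -> exists e, maxterm lt f = Some e.
Proof.
case e: (maxterm lt f) => [x|]; first by exists x.
case/negP; apply/eqP/rowP => j; rewrite mxE; apply/mpolyP => t.
rewrite mcoeff0; apply/eqP/negPn/negP; rewrite -[_ == 0]negbK -mem_vsupp.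
by rewrite (seq_max_None e).
Qed.

Lemma maxtermP (D : ore_data n R) (f : 'rV[ore D]_m) e :
  ore_coef (f 0 e.2) e.1 != 0 -> fbelow true e f -> maxterm lt f = Some e.
Proof.
move=> fe bf; apply: seq_maxP => //; first by case: e fe {bf} => t i; rewrite mem_vsupp.
by case=> t i; rewrite mem_vsupp => /bf; rewrite tmul_unit belowT.
Qed.

Lemma maxterm_below (D : ore_data n R) (f : 'rV[ore D]_m) e :
  maxterm lt f = Some e -> fbelow true e f.
Proof.
move=> fe j t nz; rewrite tmul_unit belowT.
by apply: (seq_max_ge lt_wo fe); rewrite mem_vsupp.
Qed.

Lemma lcoef_neq0 (D : ore_data n R) (f : 'rV[ore D]_m) e :
  maxterm lt f = Some e -> lcoef lt f != 0.
Proof.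
move=> fe; rewrite /lcoef fe; have := seq_max_mem fe.
by case: e {fe} => t i; rewrite mem_vsupp.
Qed.

Lemma mmonE (D : ore_data n R) c t (i j : 'I_m) s :
  ore_coef (mmon D c t i 0 j) s = if (i == j) && (t == s) then c else 0.
Proof.
rewrite /mmon !mxE eqxx /= eq_sym.
case: eqVneq => _; rewrite ?mulr1 ?mulr0 /ore_coef ?mcoeff0 //=.
by rewrite mcoeffZ mcoeffX; case: eqP; rewrite ?mulr1 ?mulr0.
Qed.

Lemma maxmon_eq (D : ore_data n R) (f : 'rV[ore D]_m) c t i : f != 0 ->
  maxmon lt f = mmon (graded D) c t i ->
  [/\ maxterm lt f = Some (t, i), lcoef lt f = c & c != 0].
Proof.
move=> /maxterm_exists[[t' i'] fe]; rewrite /maxmon fe => E.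
have nz := lcoef_neq0 fe.
have := congr1 (fun h : 'rV[ore (graded D)]_m => ore_coef (h 0 i') t') E.
rewrite !mmonE !eqxx /=; case: ifP => [/andP[/eqP-> /eqP->] <- //|_ z].
by rewrite z eqxx in nz.
Qed.

Lemma maxmon_belowB (D : ore_data n R) (f : 'rV[ore D]_m) e j :
  maxterm lt f = Some e ->
  pbelow false e (0%MM, j) ((f 0 j : {mpoly R[n]}) - (maxmon lt f 0 j : {mpoly R[n]})).
Proof.
move=> fe t nz; rewrite tmul_unit belowF.
have [E nf] : (t, j) != e /\ ore_coef (f 0 j) t != 0.
  move: nz; rewrite mcoeffB /maxmon fe -[X in _ - X]/(ore_coef (mmon _ _ _ _ 0 j) t).
  rewrite mmonE /lcoef fe; have [<-|ne] := eqVneq (t, j) e.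
    by rewrite !eqxx subrr eqxx.
  case: ifP => [/andP[/eqP ej /eqP et]|_]; last by rewrite subr0.
  by rewrite -ej -et -surjective_pairing eqxx in ne.
have := maxterm_below fe nf.
by rewrite tmul_unit belowT (negbTE E).
Qed.

End Bounds.

Lemma lspan0 (A : nzRingType) (V : lmodType A) (P : V -> Prop) : lspan P 0.
Proof. by exists [::]; rewrite big_nil. Qed.

Lemma lspanD (A : nzRingType) (V : lmodType A) (P : V -> Prop) x y :
  lspan P x -> lspan P y -> lspan P (x + y).
Proof.
move=> [s [Ps ->]] [t [Pt ->]]; exists (s ++ t); split; last by rewrite big_cat.
by move=> p; rewrite mem_cat => /orP[/Ps|/Pt].
Qed.

Lemma lspanZ (A : nzRingType) (V : lmodType A) (P : V -> Prop) a x :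
  P x -> lspan P (a *: x).
Proof.
by move=> Px; exists [:: (a, x)]; split=> [p|]; rewrite ?inE ?big_seq1 // => /eqP->.
Qed.

Section Components.
Variables (n : nat) (R : nzRingType) (D : ore_data n R) (m u : nat).
Variable lt : rel (mterm n m).
Variable g : 'I_u -> 'rV[ore D]_m.
Variables (c : 'I_u -> R) (tau : 'I_u -> 'X_{1..n}) (l : 'I_u -> 'I_m).
Hypothesis g_maxmon :
  forall i, maxmon lt (g i) = mmon (graded D) (c i) (tau i) (l i).
Implicit Types (e : mterm n m) (s t : 'X_{1..n}).
Local Notation gvec := 'rV[ore (graded D)]_u.
Implicit Types x y : gvec.

Definition vcoef x i t : R := ore_coef (x 0 i) t.

Lemma gvecP x y : (forall i t, vcoef x i t = vcoef y i t) -> x = y.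
Proof. by move=> xy; apply/rowP=> i; apply/mpolyP=> t; apply: xy. Qed.

Lemma vcoefD x y i t : vcoef (x + y) i t = vcoef x i t + vcoef y i t.
Proof. by rewrite /vcoef mxE [LHS]mcoeffD. Qed.

Lemma vcoef0 i t : vcoef 0 i t = 0.
Proof. by rewrite /vcoef mxE [LHS]mcoeff0. Qed.

Lemma vcoef_mon d w x i t :
  vcoef ((d *: oreX w : ore (graded D)) *: x) i t
    = if (w <= t)%MM then d * alpha_term D w (vcoef x i (t - w)%MM) else 0.
Proof.
rewrite /vcoef mxE /ore_coef [X in X@_t]ore_mulZl mcoeffZ ore_mulXl.
by rewrite graded_ore_termE; case: ifP => _; rewrite ?mulr0.
Qed.

Lemma scale_mon1 x : (1 *: oreX 0 : ore (graded D)) *: x = x.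
Proof.
by apply: gvecP => i t; rewrite vcoef_mon lem0m alpha_term0 subm0 mul1r.
Qed.

Definition weight (i : 'I_u) : mterm n m := (tau i, l i).

Lemma tdvd_weight i e : tdvd (weight i) e -> tmul (e.1 - tau i) (weight i) = e.
Proof. by case: e => s j /andP[/= /eqP<- /submK] e; rewrite /tmul /= e. Qed.

Lemma tdvd_tmul i t : tdvd (weight i) (tmul t (weight i)).
Proof. by rewrite /tdvd /= eqxx lem_addl. Qed.

Definition hcomp e x : gvec :=
  \row_i (if tdvd (weight i) e then vcoef x i (e.1 - tau i)%MM *: oreX (e.1 - tau i)
          else 0 : ore (graded D)).

Lemma vcoef_hcomp e x i t :
  vcoef (hcomp e x) i t = if tmul t (weight i) == e then vcoef x i t else 0.
Proof.
rewrite {1}/vcoef mxE; case: eqVneq => [<-|ne].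
  by rewrite tdvd_tmul /= addmK /ore_coef mcoeffZ mcoeffX eqxx mulr1.
case: ifP => [/tdvd_weight E|_]; last by rewrite /ore_coef mcoeff0.
rewrite /ore_coef mcoeffZ mcoeffX; case: eqP => [tE|]; last by rewrite mulr0.
by rewrite -tE E eqxx in ne.
Qed.

Lemma hcompD e x y : hcomp e (x + y) = hcomp e x + hcomp e y.
Proof.
by apply: gvecP => i t; rewrite !(vcoefD, vcoef_hcomp); case: ifP; rewrite ?addr0.
Qed.

Lemma hcomp0 e : hcomp e 0 = 0.
Proof. by apply: gvecP => i t; rewrite vcoef_hcomp !vcoef0; case: ifP. Qed.

Definition hdeg e x : Prop := forall i t, vcoef x i t != 0 -> tmul t (weight i) = e.

Lemma hcomp_id e x : hdeg e x -> hcomp e x = x.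
Proof.
move=> hx; apply: gvecP => i t; rewrite vcoef_hcomp; case: eqP => // ne.
by apply/esym/eqP/negPn/negP => /hx.
Qed.

Lemma hcomp_ne e e' x : hdeg e' x -> e' != e -> hcomp e x = 0.
Proof.
move=> hx ne; apply: gvecP => i t; rewrite vcoef_hcomp vcoef0; case: eqP => // E.
by apply/eqP/negPn/negP => /hx; rewrite E => E'; rewrite E' eqxx in ne.
Qed.

Lemma hdeg_mon e d w x :
  hdeg e x -> hdeg (tmul w e) ((d *: oreX w : ore (graded D)) *: x).
Proof.
move=> hx i t; rewrite vcoef_mon; case: ifP => [wt nz|_]; last by rewrite eqxx.
rewrite -(hx i (t - w)%MM) -?tmulA; first by rewrite addmC submK.
by apply: contraNneq nz => ->; rewrite raddf0 mulr0.
Qed.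

Lemma syzygy_mapD x y :
  syzygy_map lt g (x + y) = syzygy_map lt g x + syzygy_map lt g y.
Proof. by rewrite -big_split; apply: eq_bigr => i _; rewrite mxE scalerDl. Qed.

Lemma syzygy_mapZ a x : syzygy_map lt g (a *: x) = a *: syzygy_map lt g x.
Proof. by rewrite scaler_sumr; apply: eq_bigr => i _; rewrite mxE scalerA. Qed.

Lemma syzygy_map0 : syzygy_map lt g 0 = 0.
Proof. by apply: big1 => i _; rewrite mxE scale0r. Qed.

Definition syzcoef x e : R :=
  \sum_i if tdvd (weight i) e
         then vcoef x i (e.1 - tau i)%MM * alpha_term D (e.1 - tau i) (c i) else 0.

Lemma syzygy_mapE x j t : ore_coef (syzygy_map lt g x 0 j) t = syzcoef x (t, j).
Proof.
rewrite /syzygy_map summxE [LHS]raddf_sum /=; apply: eq_bigr => i _.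
rewrite g_maxmon /mmon !mxE eqxx /= eq_sym /tdvd /=.
case: eqVneq => _ /=; last by rewrite !mulr0 mcoeff0.
by rewrite mulr1 graded_mulmonE.
Qed.

Lemma syzcoef_hcomp e e' x :
  syzcoef (hcomp e x) e' = if e' == e then syzcoef x e else 0.
Proof.
rewrite /syzcoef; case: eqVneq => [->|ne].
  apply: eq_bigr => i _; case: ifP => // /tdvd_weight E.
  by rewrite vcoef_hcomp E eqxx.
apply: big1 => i _; case: ifP => // /tdvd_weight E.
by rewrite vcoef_hcomp E (negbTE ne) mul0r.
Qed.

Lemma syzygy_map_hcomp e x :
  syzygy_map lt g (hcomp e x) = mmon (graded D) (syzcoef x e) e.1 e.2.
Proof.
apply/rowP=> j; apply/mpolyP=> t.
rewrite -[LHS]/(ore_coef _ t) -[RHS]/(ore_coef _ t) syzygy_mapE syzcoef_hcomp mmonE.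
by case: e => s i /=; rewrite xpair_eqE andbC [j == i]eq_sym [t == s]eq_sym.
Qed.

Lemma hcomp_sum x : exists r, x = \sum_(e <- r) hcomp e x.
Proof.
exists (undup [seq tmul t (weight i) | i <- enum 'I_u, t <- ore_supp (x 0 i)]).
apply: gvecP => i t; rewrite /vcoef summxE [RHS]raddf_sum /=.
rewrite (eq_bigr _ (fun e _ => vcoef_hcomp e x i t)) -/(vcoef x i t).
have [z|nz] := eqVneq (vcoef x i t) 0.
  by rewrite [LHS]z big1 // => e _; case: ifP.
rewrite -big_mkcond /= -big_filter.
rewrite (eq_filter (a2 := pred1 (tmul t (weight i)))); last first.
  by move=> e /=; rewrite eq_sym.
rewrite filter_pred1_uniq ?undup_uniq ?big_seq1 // mem_undup.
by apply/allpairsPdep; exists i, t; rewrite mem_enum mcoeff_msupp.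
Qed.

Definition syz e (d : 'rV[R]_u) : gvec := \row_i (d 0 i *: quot_term D tau l e i).

Lemma vcoef_syz e d i t :
  vcoef (syz e d) i t = if tmul t (weight i) == e then d 0 i else 0.
Proof.
rewrite /vcoef mxE /ore_coef mcoeffZ /quot_term; case: eqVneq => [<-|ne].
  by rewrite tdvd_tmul /= addmK mcoeffX eqxx mulr1.
case: ifP => [/tdvd_weight E|_]; last by rewrite mcoeff0 mulr0.
rewrite mcoeffX; case: eqP => [tE|]; last by rewrite mulr0.
by rewrite -tE E eqxx in ne.
Qed.

Lemma hdeg_syz e d : hdeg e (syz e d).
Proof. by move=> i t; rewrite vcoef_syz; case: (tmul _ _ =P e) => //; rewrite eqxx. Qed.

Lemma syzygy_map_syz e (d : 'rV[R]_u) :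
  \sum_i d 0 i * quot_coef D c tau l e i = 0 -> syzygy_map lt g (syz e d) = 0.
Proof.
move=> d0; rewrite -(hcomp_id (@hdeg_syz e d)) syzygy_map_hcomp.
suff -> : syzcoef (syz e d) e = 0 by rewrite /mmon scale0r scale0r.
rewrite -d0; apply: eq_bigr => i _; rewrite /quot_coef -/(weight i).
by case: ifP => [/tdvd_weight E|_]; rewrite ?mulr0 // vcoef_syz E eqxx.
Qed.

Section Span.
Variable P : gvec -> Prop.

Inductive hspan e : gvec -> Prop :=
| hspan0 : hspan e 0
| hspan_cons d w e' sigma y :
    P sigma -> hdeg e' sigma -> tmul w e' = e -> hspan e y ->
    hspan e ((d *: oreX w : ore (graded D)) *: sigma + y).

Lemma hspanD e x y : hspan e x -> hspan e y -> hspan e (x + y).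
Proof.
move=> hx hy; elim: hx => [|d w e' sigma z Ps hs we _ IHz]; first by rewrite add0r.
by rewrite -addrA; apply: hspan_cons hs we IHz.
Qed.

Lemma hspan_mon e d w x :
  hspan e x -> hspan (tmul w e) ((d *: oreX w : ore (graded D)) *: x).
Proof.
elim=> [|b s e' sigma y Ps hs <- _ IHy]; first by rewrite scaler0; apply: hspan0.
rewrite scalerDr scalerA graded_mulE.
by apply: hspan_cons hs _ IHy => //; rewrite tmulA.
Qed.

Lemma hspan_lspan e x : hspan e x -> lspan P x.
Proof.
elim=> [|d w e' sigma y Ps _ _ _ IHy]; first exact: lspan0.
by apply: lspanD IHy; apply: lspanZ.
Qed.

End Span.

End Components.

Section Kernel.
Variables (R : nzRingType) (n : nat) (D : ore_data n R) (m u : nat).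
Hypothesis alpha_auto : forall i, bijective (alpha D i).
Variable lt : rel (mterm n m).
Variable g : 'I_u -> 'rV[ore D]_m.
Variables (c : 'I_u -> R) (tau : 'I_u -> 'X_{1..n}) (l : 'I_u -> 'I_m).
Hypothesis g_maxmon :
  forall i, maxmon lt (g i) = mmon (graded D) (c i) (tau i) (l i).
Variable C : mterm n m -> seq 'rV[R]_u.
Hypothesis C_gen : forall e, lcm_term tau l e ->
  generates (fun d => d \in C e)
    (fun d => \sum_i d 0 i * quot_coef D c tau l e i = 0).
Variable S' : 'rV[ore (graded D)]_u -> Prop.
Hypothesis S'_span : forall sigma, syzygy_set tau l C sigma -> ~ S' sigma ->
  exists s : seq (R * 'X_{1..n} * 'rV[ore (graded D)]_u),
    (forall p, p \in s -> S' p.2) /\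
    sigma = \sum_(p <- s) (p.1.1 *: oreX p.1.2 : ore (graded D)) *: p.2.
Hypothesis S'_sub : forall sigma, S' sigma -> syzygy_set tau l C sigma.
Implicit Types (e : mterm n m) (x y : 'rV[ore (graded D)]_u).

Local Notation syz := (@syz n R D m u tau l).
Local Notation hdeg := (@hdeg n R D m u tau l).
Local Notation hspan := (@hspan n R D m u tau l S').
Local Notation hcomp := (@hcomp n R D m u tau l).
Local Notation syzcoef := (@syzcoef n R D m u c tau l).

Lemma syzygy_set_kernel sigma :
  syzygy_set tau l C sigma -> syzygy_map lt g sigma = 0.
Proof.
move=> [e [d [le dC ->]]]; apply: (syzygy_map_syz g_maxmon (e := e)).
by apply/(C_gen le); rewrite -[d]scale1r; apply: lspanZ.
Qed.

(* An element of S outside S' is a combination of elements of S' of arbitrary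
   degrees; taking components of degree e keeps only those of degree e. *)
Lemma syz_hspan e d : lcm_term tau l e -> d \in C e -> hspan e (syz e d).
Proof.
move=> le dC; have hd : hdeg e (syz e d) by apply: hdeg_syz.
have [Sd|nSd] := classic (S' (syz e d)).
  rewrite -[syz e d]addr0 -[syz e d]scale_mon1.
  by apply: hspan_cons Sd hd _ _; [apply: tmul0 | apply: hspan0].
have [|s [Ss Es]] := S'_span _ nSd; first by exists e, d.
rewrite -(hcomp_id hd) Es; elim: s Ss {Es} => [|p s IHs] Ss.
  by rewrite big_nil hcomp0; apply: hspan0.
rewrite big_cons hcompD; apply: hspanD; last first.
  by apply: IHs => q qs; apply: Ss; rewrite inE qs orbT.
have Sp : S' p.2 by apply: Ss; rewrite inE eqxx.
have [e' [d' [_ _ Ep]]] := S'_sub Sp.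
have hp : hdeg e' p.2 by rewrite Ep; apply: hdeg_syz.
have hq := hdeg_mon (d := p.1.1) (w := p.1.2) hp.
have [E|ne] := eqVneq (tmul p.1.2 e') e; last first.
  by rewrite (hcomp_ne hq ne); apply: hspan0.
rewrite E in hq; rewrite (hcomp_id hq) -[X in hspan _ X]addr0.
by apply: hspan_cons Sp hp E _; apply: hspan0.
Qed.

Lemma syz_lspan_hspan e d : lcm_term tau l e ->
  lspan (fun d => d \in C e) d -> hspan e (syz e d).
Proof.
move=> le [s [Cs ->]]; elim: s Cs => [|p s IHs] Cs.
  rewrite big_nil (_ : syz e 0 = 0); first exact: hspan0.
  by apply: gvecP => i t; rewrite vcoef_syz vcoef0 mxE; case: ifP.
rewrite big_cons (_ : syz e (_ + _) = (p.1 *: oreX 0 : ore (graded D)) *: syz e p.2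
  + syz e (\sum_(q <- s) q.1 *: q.2)).
  apply: hspanD; last by apply: IHs => q qs; apply: Cs; rewrite inE qs orbT.
  rewrite -[e in hspan e]tmul0; apply/hspan_mon/syz_hspan => //.
  by apply: Cs; rewrite inE eqxx.
apply: gvecP => i t; rewrite vcoefD vcoef_mon !vcoef_syz lem0m alpha_term0 subm0.
by rewrite !mxE; case: ifP => _; rewrite ?mulr0 ?addr0.
Qed.

Lemma kernel_hspan e x : syzcoef x e = 0 -> hspan e (hcomp e x).
Proof.
move=> x0; pose H := [set i | tdvd (weight tau l i) e].
have [H0|Hn0] := eqVneq H set0.
  rewrite (_ : hcomp e x = 0); first exact: hspan0.
  apply: gvecP => i t; rewrite vcoef_hcomp vcoef0; case: eqP => // E.
  have : i \in H by rewrite inE -E tdvd_tmul.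
  by rewrite H0 inE.
pose e0 : mterm n m := (\big[@mlcm n/0%MM]_(i in H) tau i, e.2).
have lcm_e0 : lcm_term tau l e0.
  by exists H; split=> // i; rewrite inE => /andP[/eqP].
have le_e0 : (e0.1 <= e.1)%MM.
  by rewrite lem_big_mlcm; apply/forall_inP => i; rewrite inE => /andP[].
have tau_e0 i : tdvd (weight tau l i) e -> tdvd (weight tau l i) e0.
  move=> ie; move: (ie) => /andP[ie2 _]; rewrite /tdvd ie2 /=.
  have := lepm_refl e0.1; rewrite {1}/e0 lem_big_mlcm => /forall_inP; apply.
  by rewrite inE.
pose w := (e.1 - e0.1)%MM.
have we : tmul w e0 = e by rewrite /tmul submK // -surjective_pairing.
have e0_tau i : tdvd (weight tau l i) e0 -> tdvd (weight tau l i) e.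
  by case/andP=> i2 i1; rewrite /tdvd i2 (lepm_trans i1).
have w_tau i : tdvd (weight tau l i) e ->
    (e.1 - tau i = w + (e0.1 - tau i))%MM.
  move=> ie; apply/mnmP=> k; rewrite !(mnmDE, mnmBE).
  have /andP[_ /mnm_lepP/(_ k) /= ?] := tau_e0 i ie; have /mnm_lepP/(_ k) ? := le_e0.
  by rewrite addnBA // subnK.
have [beta alphaK betaK] := alpha_term_bij w alpha_auto.
pose z : 'rV[R]_u := \row_i beta (vcoef x i (e.1 - tau i)%MM).
have z0 : \sum_i z 0 i * quot_coef D c tau l e0 i = 0.
  apply: (can_inj alphaK); rewrite raddf0 raddf_sum -[RHS]x0 /=.
  apply: eq_bigr => i _; rewrite /quot_coef -/(weight tau l i).
  case: ifPn => [/e0_tau ie|nie]; last first.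
    rewrite mulr0 raddf0; case: ifP => // /tau_e0.
    by rewrite (negbTE nie).
  by rewrite ie alpha_termM mxE betaK (w_tau i ie) alpha_termA.
have zC := syz_lspan_hspan lcm_e0 ((C_gen lcm_e0 z).1 z0).
rewrite (_ : hcomp e x = (1 *: oreX w : ore (graded D)) *: syz e0 z).
  by rewrite -[e in hspan e]we; apply: hspan_mon.
apply: gvecP => i t; rewrite vcoef_hcomp vcoef_mon vcoef_syz mul1r.
case: ifPn => [/eqP E|ne].
  have ie : tdvd (weight tau l i) e by rewrite -E tdvd_tmul.
  have tE : t = (e.1 - tau i)%MM by rewrite -E /= addmK.
  have wt : (w <= t)%MM by rewrite tE (w_tau i ie) lem_addr.
  have -> : tmul (t - w) (weight tau l i) = e0.
    by apply: (@tmul_inj _ _ w); rewrite -tmulA addmC submK // we.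
  by rewrite wt eqxx mxE betaK tE.
case: ifP => // wt; case: eqP => [E|_]; last by rewrite raddf0.
by case/eqP: ne; rewrite -we -E -tmulA addmC submK.
Qed.

Lemma S'_gebauer_moeller : (forall i, g i != 0) -> gebauer_moeller_set lt g S'.
Proof.
move=> g_neq0; split=> [h Sh|h]; last split.
- have [e [d [_ _ ->]]] := S'_sub Sh.
  exists (fun i => if tdvd (weight tau l i) e then d 0 i else 0).
  exists (fun i => e.1 - tau i)%MM; split.
    apply/rowP=> i; rewrite !mxE /quot_term -/(weight tau l i).
    by case: ifP => _; rewrite ?scaler0 ?scale0r.
  have max_g i : tdvd (weight tau l i) e ->
      omap (tmul (e.1 - tau i)) (maxterm lt (g i)) = Some e.
    move=> ie; have [-> _ _] := maxmon_eq (g_neq0 i) (g_maxmon i).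
    by rewrite /= tdvd_weight.
  move=> i j; case: ifP => [ie _|]; last by rewrite eqxx.
  by case: ifP => [je _|]; rewrite ?eqxx // !max_g.
- move=> h0; have [r ->] := hcomp_sum tau l h; elim: r => [|e r IHr].
    by rewrite big_nil; apply: lspan0.
  rewrite big_cons; apply: lspanD IHr; apply: (hspan_lspan (e := e)).
  apply: kernel_hspan; case: e => t j.
  by rewrite -(syzygy_mapE g_maxmon) h0 mxE /ore_coef mcoeff0.
- case=> s [Ss ->]; elim: s Ss => [|p s IHs] Ss; first by rewrite big_nil syzygy_map0.
  rewrite big_cons syzygy_mapD syzygy_mapZ IHs => [|q qs]; last first.
    by apply: Ss; rewrite inE qs orbT.
  by rewrite syzygy_set_kernel ?scaler0 ?addr0 //; apply/S'_sub/Ss; rewrite inE eqxx.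
Qed.

End Kernel.

Section Criterion.
Variables (R : nzRingType) (n : nat) (D : ore_data n R) (m u : nat).
Variables (prec : rel 'X_{1..n}) (lt : rel (mterm n m)).
Hypothesis prec_order : term_order prec.
Hypothesis lt_order : module_term_order prec lt.
Variable g : 'I_u -> 'rV[ore D]_m.
Hypothesis g_neq0 : forall i, g i != 0.
Variables (c : 'I_u -> R) (tau : 'I_u -> 'X_{1..n}) (l : 'I_u -> 'I_m).
Hypothesis g_maxmon :
  forall i, maxmon lt (g i) = mmon (graded D) (c i) (tau i) (l i).
Implicit Types (e : mterm n m) (x y z : 'rV[ore (graded D)]_u).
Implicit Types (f : 'rV[ore D]_m).

Local Notation weight := (@weight n m u tau l).
Local Notation hdeg := (@hdeg n R D m u tau l).
Local Notation hcomp := (@hcomp n R D m u tau l).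
Local Notation syzcoef := (@syzcoef n R D m u c tau l).
Local Notation below := (below lt).
Local Notation pbelow := (@pbelow n R m lt).

Let lt_wo : well_order lt. Proof. by case: lt_order. Qed.

Lemma maxterm_g i : maxterm lt (g i) = Some (weight i).
Proof. by have [-> _ _] := maxmon_eq (g_neq0 i) (g_maxmon i). Qed.

Definition combine x : 'rV[ore D]_m := \sum_i ungraded (x 0 i) *: g i.

Definition ore_act (p : ore D) x : 'rV[ore (graded D)]_u :=
  \row_i (p * ungraded (x 0 i) : ore D).

Lemma combineD x y : combine (x + y) = combine x + combine y.
Proof.
rewrite -big_split; apply: eq_bigr => i _; by rewrite mxE /= -scalerDl.
Qed.

Lemma combineB x y : combine (x - y) = combine x - combine y.
Proof.
by apply: (addIr (combine y)); rewrite -combineD !subrK.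
Qed.

Lemma combine0 : combine 0 = 0.
Proof. by apply: big1 => i _; rewrite mxE /ungraded scale0r. Qed.

Lemma combine_act p x : combine (ore_act p x) = p *: combine x.
Proof.
rewrite scaler_sumr; by apply: eq_bigr => i _; rewrite mxE scalerA.
Qed.

Lemma lspan_combine f :
  lspan (fun h => exists i, h = g i) f <-> exists x, f = combine x.
Proof.
split=> [[s [gs ->]]|[x ->]].
  elim: s gs => [|p s IHs] gs; first by exists 0; rewrite big_nil combine0.
  have [q qs|x Ex] := IHs; first by apply: gs; rewrite inE qs orbT.
  have [i Ei] : exists i, p.2 = g i by apply: gs; rewrite inE eqxx.
  exists ((\row_j (if j == i then p.1 else 0 : ore D)) + x).
  rewrite big_cons combineD -Ex; congr (_ + _).
  rewrite /combine (bigD1 i) //= big1 ?addr0 => [|j /negbTE ji].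
    by rewrite mxE eqxx Ei.
  by rewrite mxE ji /ungraded scale0r.
exists [seq (ungraded (x 0 i), g i) | i <- enum 'I_u]; split.
  by move=> _ /mapP[i _ ->]; exists i.
by rewrite big_map /combine big_enum.
Qed.

Definition vbelow b e x : Prop := forall i, pbelow b e (weight i) (x 0 i).

Lemma vbelow0 b e : vbelow b e 0.
Proof. by move=> i; rewrite mxE; apply: pbelow0. Qed.

Lemma vbelowD b e x y : vbelow b e x -> vbelow b e y -> vbelow b e (x + y).
Proof. by move=> bx b_y i; rewrite mxE; apply: pbelowD. Qed.

Lemma vbelow_trans b1 b2 e e' x :
  vbelow b1 e' x -> below b2 e e' -> vbelow (b1 && b2) e x.
Proof. by move=> bx be i; apply: (pbelow_trans lt_order (bx i) be). Qed.

Lemma vbelow_hdeg e x : hdeg e x -> vbelow true e x.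
Proof. by move=> hx i t /hx ->; apply: belowxx. Qed.

Lemma vbelow_hcompB e x : vbelow true e x -> vbelow false e (x - hcomp e x).
Proof.
move=> bx i t; rewrite -[_@__]/(vcoef _ i t) -scaleN1r vcoefD.
have -> : vcoef (-1 *: hcomp e x) i t = - vcoef (hcomp e x) i t.
  by rewrite scaleN1r /vcoef mxE /ore_coef [LHS]mcoeffN.
rewrite vcoef_hcomp; case: (eqVneq (tmul t _) e) => [_|ne]; first by rewrite subrr eqxx.
by rewrite subr0 => /bx; rewrite belowT (negbTE ne) belowF.
Qed.

Lemma vbelow_act b e d w x :
  vbelow b e x -> vbelow b (tmul w e) (ore_act (d *: oreX w) x).
Proof.
move=> bx i; rewrite mxE [X in pbelow _ _ _ X]ore_mulZl ore_mulXl.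
by apply: pbelowZ; apply: (pbelow_term prec_order lt_order) (bx i).
Qed.

Lemma vbelow_monB e d w x : vbelow true e x ->
  vbelow false (tmul w e)
    ((d *: oreX w : ore (graded D)) *: x - ore_act (d *: oreX w) x).
Proof.
move=> bx i; rewrite !mxE.
rewrite [X in pbelow _ _ _ (X - _)]ore_mulZl [X in pbelow _ _ _ (_ - X)]ore_mulZl.
rewrite !ore_mulXl -scalerBr; apply: pbelowZ.
rewrite -opprB; apply: pbelowN; apply: (pbelow_termB prec_order lt_order) (bx i) => //.
Qed.

Lemma vbelow_exists x : x != 0 -> exists e, vbelow true e x /\
  exists i t, vcoef x i t != 0 /\ e = tmul t (weight i).
Proof.
move=> x0; pose s := [seq tmul t (weight i) | i <- enum 'I_u, t <- ore_supp (x 0 i)].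
have mem_s i t : vcoef x i t != 0 -> tmul t (weight i) \in s.
  by move=> nz; apply/allpairsPdep; exists i, t; rewrite mem_enum mcoeff_msupp.
case E: (seq_max lt s) => [e|].
  exists e; split.
    by move=> i t /mem_s; rewrite belowT; apply: seq_max_ge lt_wo E _.
  have /allpairsPdep[i [t [_ + ->]]] := seq_max_mem E.
  by rewrite mcoeff_msupp => nz; exists i, t.
case/eqP: x0; apply: gvecP => i t; rewrite vcoef0; apply/eqP/negPn/negP => /mem_s.
by rewrite (seq_max_None E).
Qed.

Lemma vbelow_lt e x : vbelow false e x -> x != 0 ->
  exists2 e', lt e' e & vbelow true e' x.
Proof.
move=> bx /vbelow_exists[e' [bx' [i [t [nz E]]]]]; exists e' => //.
by have := bx i t nz; rewrite -E belowF.
Qed.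

Lemma combine_syzygyB e x : vbelow true e x -> forall j, pbelow false e (0%MM, j)
  ((combine x 0 j : {mpoly R[n]}) - (syzygy_map lt g x 0 j : {mpoly R[n]})).
Proof.
move=> bx j; rewrite /combine /syzygy_map !summxE -sumrB.
apply: pbelow_sum => i _; rewrite !mxE.
apply: (pbelow_mulB prec_order lt_order (bx i)) => //.
  exact: (maxterm_below lt_order (maxterm_g i)).
exact: (maxmon_belowB lt_order (maxterm_g i)).
Qed.

Lemma combine_below e x : vbelow true e x -> fbelow lt true e (combine x).
Proof.
move=> bx j; rewrite /combine !summxE; apply: pbelow_sum => i _; rewrite !mxE.
apply: (pbelow_mul prec_order lt_order (bx i)) => //.
exact: (maxterm_below lt_order (maxterm_g i)).
Qed.

Lemma combine_coef e x : vbelow true e x ->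
  ore_coef (combine x 0 e.2) e.1 = syzcoef x e.
Proof.
move=> bx; apply/eqP; rewrite -subr_eq0; apply/negPn/negP => nz.
have := @combine_syzygyB e x bx e.2 e.1.
rewrite mcoeffB -[X in _ - X]/(ore_coef _ _) (syzygy_mapE g_maxmon).
rewrite -surjective_pairing => /(_ nz); rewrite belowF tmul_unit -surjective_pairing.
by case: lt_wo => ->.
Qed.

Lemma fbelow_lt f e e' : fbelow lt true e f -> maxterm lt f = Some e' ->
  ore_coef (f 0 e.2) e.1 = 0 -> lt e' e.
Proof.
move=> bf /seq_max_mem; case: e' => t i; rewrite mem_vsupp => nz f0.
have := bf i t nz; rewrite tmul_unit belowT => /orP[/eqP E|//].
by rewrite -E /= in f0; rewrite f0 eqxx in nz.
Qed.

Lemma groebner_division : left_groebner_basis lt g ->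
  forall e x, maxterm lt (combine x) = Some e ->
  exists2 y, combine x = combine y & vbelow true e y.
Proof.
move=> gb; have wf : well_founded lt by case: lt_wo.
elim/(well_founded_ind wf) => e IHe x xe.
have x0 : combine x != 0.
  apply: contraPneq xe => ->; rewrite /maxterm => /seq_max_mem.
  by case: (e) => t i; rewrite mem_vsupp mxE /ore_coef mcoeff0 eqxx.
have [||s [gs Es]] := gb (combine x); first by apply/lspan_combine; exists x.
  by [].
have {gs} [y hy Ey] : exists2 y, hdeg e y & maxmon lt (combine x) = syzygy_map lt g y.
  rewrite {}Es; rewrite xe in gs; elim: s gs => [|p s IHs] gs.
    exists 0; first by move=> i t; rewrite vcoef0 eqxx.
    by rewrite big_nil syzygy_map0.
  have [q qs|y hy Ey] := IHs; first by apply: gs; rewrite inE qs orbT.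
  have [|_] := gs p _; first by rewrite inE eqxx.
  rewrite maxterm_g => -[pe].
  exists ((p.1.1 *: oreX p.1.2 : ore (graded D)) *: delta_mx 0 p.2 + y).
    move=> i t; rewrite vcoefD vcoef_mon.
    have [->|/hy->//] := eqVneq (vcoef y i t) 0.
    rewrite addr0; case: ifP => [wt|_]; last by rewrite eqxx.
    rewrite /vcoef mxE /=; case: (eqVneq i p.2) => [->|_]; last first.
      by rewrite /ore_coef mcoeff0 raddf0 mulr0 eqxx.
    rewrite /ore_coef /= [X in alpha_term _ _ X]mcoeff1.
    case: (eqVneq (t - p.1.2)%MM 0%MM) => [t0 _|_]; last first.
      by rewrite raddf0 mulr0 eqxx.
    by rewrite -pe -(submK wt) t0 add0m.
  rewrite big_cons Ey syzygy_mapD syzygy_mapZ; congr (_ *: _ + _).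
  rewrite /syzygy_map (bigD1 p.2) //= big1 ?addr0 => [|i /negbTE ip].
    by rewrite mxE !eqxx scale1r.
  by rewrite mxE ip andbF scale0r.
have bx := maxterm_below lt_order xe; have b_y := vbelow_hdeg hy.
have [z0|z0] := eqVneq (combine (x - y)) 0.
  by exists y => //; apply/eqP; rewrite -subr_eq0 -combineB z0.
have [e' ze] := maxterm_exists lt z0.
have lt_e : lt e' e.
  apply: fbelow_lt ze _.
    move=> j; rewrite combineB !mxE; apply: pbelowD (bx j) _; apply: pbelowN.
    exact: combine_below.
  rewrite combineB !mxE /ore_coef mcoeffB; apply/eqP; rewrite subr_eq0.
  rewrite -[X in _ == X]/(ore_coef (combine y 0 e.2) e.1) (combine_coef b_y).
  have := congr1 (fun f : 'rV_m => ore_coef (f 0 e.2) e.1) Ey.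
  rewrite /maxmon xe mmonE !eqxx /lcoef xe (syzygy_mapE g_maxmon).
  by rewrite -surjective_pairing /= => H; apply/eqP; exact: H.
have [z Ez bz] := IHe _ lt_e _ ze.
exists (z + y); first by rewrite combineD -Ez combineB subrK.
apply: vbelowD => //; rewrite -[true]/(true && true); apply: vbelow_trans bz _.
by rewrite belowT lt_e orbT.
Qed.

Lemma vbelow_groebner_rep e x y :
  maxterm lt (combine x) = Some e -> combine x = combine y -> vbelow true e y ->
  left_groebner_rep prec lt g (combine x).
Proof.
move=> xe xy b_y; exists (fun i => ungraded (y 0 i)); split=> // i yi.
case E: (ore_maxterm prec (ungraded (y 0 i))) => [a|]; last first.
  case/eqP: yi; apply/mpolyP => t; rewrite mcoeff0.
  apply/eqP/negPn/negP; rewrite -mcoeff_msupp.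
  by have := seq_max_None E; rewrite /ore_supp => ->.
exists a, (weight i), e; split=> //; first exact: maxterm_g.
rewrite -belowT; apply: (b_y i); rewrite -mcoeff_msupp.
exact: seq_max_mem E.
Qed.

Lemma groebner_rep_vbelow f : left_groebner_rep prec lt g f ->
  exists2 z, f = combine z & forall e, maxterm lt f = Some e -> vbelow true e z.
Proof.
case=> h [fE hf]; exists (\row_i (h i : ore (graded D))).
  by rewrite fE; apply: eq_bigr => i _; rewrite mxE.
move=> e fe i t; rewrite mxE => nz.
have hi : h i != 0 by apply: contraNneq nz => ->; rewrite mcoeff0.
have [a [t' [s [ha]]]] := hf i hi; rewrite maxterm_g fe => -[<-] [<-] ae.
have [pw _] := prec_order.
have : below true (tmul a (weight i)) (tmul t (weight i)).
  rewrite belowT.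
  have /(seq_max_ge pw ha) : t \in ore_supp (h i) by rewrite mcoeff_msupp.
  case/orP=> [/eqP->|ta]; first by rewrite eqxx.
  by case: lt_order => _ mon _; rewrite (mon _ _ _ ta) orbT.
by move/(below_trans lt_order (b2 := true)); apply; rewrite belowT.
Qed.

Section Reduction.
Variable S' : 'rV[ore (graded D)]_u -> Prop.
Hypothesis S'_rep : forall sigma, S' sigma ->
  left_groebner_rep prec lt g (combine sigma).
Hypothesis S'_ker : forall sigma, S' sigma -> syzygy_map lt g sigma = 0.

Lemma hspan_reduce e y : @hspan n R D m u tau l S' e y ->
  exists2 z, combine y = combine z & vbelow false e z.
Proof.
elim=> [|d w e' sigma {}y Ss hs <- _ [z yz bz]].
  by exists 0 => //; apply: vbelow0.
have [z0 sz bz0] := groebner_rep_vbelow (S'_rep Ss).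
have bs := vbelow_hdeg hs.
have {bz0} [z1 sz1 bz1] : exists2 z1, combine sigma = combine z1 & vbelow false e' z1.
  have [s0|s0] := eqVneq (combine sigma) 0.
    by exists 0; [rewrite s0 combine0 | apply: vbelow0].
  have [e0 se] := maxterm_exists lt s0.
  exists z0 => //; rewrite -[false]/(true && false).
  apply: vbelow_trans (bz0 _ se) _; rewrite belowF; apply: fbelow_lt se _.
    exact: combine_below.
  rewrite combine_coef //; case: (e') => t j.
  by rewrite -(syzygy_mapE g_maxmon) S'_ker // mxE /ore_coef mcoeff0.
exists (((d *: oreX w : ore (graded D)) *: sigma - ore_act (d *: oreX w) sigma)
        + ore_act (d *: oreX w) z1 + z).
  by rewrite 3!combineD combineB yz !combine_act sz1 subrK.
apply: vbelowD => //; apply: vbelowD; first exact: vbelow_monB.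
exact: vbelow_act.
Qed.

Hypothesis S'_span : forall e x,
  syzcoef x e = 0 -> @hspan n R D m u tau l S' e (hcomp e x).

Lemma groebner_criterion : left_groebner_basis lt g.
Proof.
move=> f /lspan_combine[x ->] {f} x0.
have [e [bx _]] : exists e, vbelow true e x /\
    exists i t, vcoef x i t != 0 /\ e = tmul t (weight i).
  by apply: vbelow_exists; apply: contraNneq x0 => ->; rewrite combine0.
have wf : well_founded lt by case: lt_wo.
elim/(well_founded_ind wf): e x x0 bx => e IHe x x0 bx.
have [s0|s0] := eqVneq (syzcoef x e) 0.
  have [z Ez bz] := hspan_reduce (S'_span s0).
  have Ex : combine x = combine ((x - hcomp e x) + z).
    by rewrite combineD combineB Ez subrK.
  rewrite Ex in x0 *.
  have [e' lt_e b'] : exists2 e', lt e' e & vbelow true e' (x - hcomp e x + z).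
    apply: vbelow_lt; first by apply: vbelowD => //; apply: vbelow_hcompB.
    by apply: contraNneq x0 => ->; rewrite combine0.
  exact: IHe lt_e _ x0 b'.
have xe : maxterm lt (combine x) = Some e.
  by apply: (maxtermP lt_order); rewrite ?combine_coef //; apply: combine_below.
exists [seq (vcoef x i (e.1 - tau i)%MM, (e.1 - tau i)%MM, i)
       | i <- enum 'I_u & tdvd (weight i) e && (vcoef x i (e.1 - tau i)%MM != 0)].
split=> [p /mapP[i + ->] /=|].
  by rewrite mem_filter => /andP[/andP[ie ->] _]; rewrite maxterm_g xe /= tdvd_weight.
rewrite big_map big_filter big_enum_cond /= {1}/maxmon xe /lcoef xe combine_coef //.
rewrite -(syzygy_map_hcomp g_maxmon) /syzygy_map [RHS]big_mkcond /=.
apply: eq_bigr => i _; rewrite mxE -/(weight i).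
case: ifP => _ /=; last by rewrite scale0r.
by case: eqVneq => [->|//]; rewrite scale0r scale0r.
Qed.

End Reduction.
End Criterion.

Theorem corollary44 (R : nzRingType) (R_domain : GRing.integral_domain_axiom R)
    (R_zacharias : left_zacharias R)
    (n : nat) (D : ore_data n R)
    (alpha_auto : forall i, bijective (alpha D i))
    (m u : nat) (prec : rel 'X_{1..n}) (lt : rel (mterm n m))
    (prec_order : term_order prec) (lt_order : module_term_order prec lt)
    (g : 'I_u -> 'rV[ore D]_m) (g_neq0 : forall i, g i != 0)
    (c : 'I_u -> R) (tau : 'I_u -> 'X_{1..n}) (l : 'I_u -> 'I_m)
    (g_maxmon : forall i, maxmon lt (g i) = mmon (graded D) (c i) (tau i) (l i))
    (C : mterm n m -> seq 'rV[R]_u)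
    (C_gen : forall e, lcm_term tau l e ->
       generates (fun d => d \in C e)
         (fun d => \sum_i d 0 i * quot_coef D c tau l e i = 0))
    (S' : 'rV[ore (graded D)]_u -> Prop)
    (S'_sub : forall sigma, S' sigma -> syzygy_set tau l C sigma)
    (S'_span : forall sigma, syzygy_set tau l C sigma -> ~ S' sigma ->
       exists s : seq (R * 'X_{1..n} * 'rV[ore (graded D)]_u),
         (forall p, p \in s -> S' p.2) /\
         sigma = \sum_(p <- s) (p.1.1 *: oreX p.1.2 : ore (graded D)) *: p.2) :
  gebauer_moeller_set lt g S' /\
  (left_groebner_basis lt g <->
   forall mu, S' mu ->
     left_groebner_rep prec lt g (\sum_i ungraded (mu 0 i) *: g i)).
Proof.
have S'_ker sigma : S' sigma -> syzygy_map lt g sigma = 0.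
  by move=> /S'_sub; apply: (syzygy_set_kernel g_maxmon C_gen).
split; first exact: (S'_gebauer_moeller alpha_auto g_maxmon C_gen S'_span S'_sub g_neq0).
split=> [gb mu _|S'_rep].
  rewrite -[X in left_groebner_rep _ _ _ X]/(combine g mu).
  have [mu0|/(maxterm_exists lt)[e mue]] := eqVneq (combine g mu) 0.
    exists (fun=> 0); split=> [|i]; last by rewrite eqxx.
    by rewrite mu0 big1 // => i _; rewrite scale0r.
  have [y Ey b_y] := groebner_division prec_order lt_order g_neq0 g_maxmon gb mue.
  exact: (vbelow_groebner_rep prec g_neq0 g_maxmon mue Ey b_y).
apply: (groebner_criterion prec_order lt_order g_neq0 g_maxmon S'_rep S'_ker).
by move=> e x; apply: (kernel_hspan alpha_auto C_gen S'_span S'_sub).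
Qed.
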